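(* Let $R=k[x_1,\dots,x_n]$ be positively graded by $\deg(x_i)=a_i\in A$, let $\Omega\subset S_A$ be a truncating subset and let $I\subset R$ be a homogeneous ideal. For $\omega\in\mathbb{R}^n$ put $$C_\Omega[\omega]=\{v\in\mathbb{R}^n \mid \operatorname{in}_v(I)_\Omega=\operatorname{in}_\omega(I)_\Omega\}.$$ Then the collection $$\mathcal{F}_\Omega(I)=\{\overline{C_\Omega[\omega]}\mid \omega\in\mathbb{R}^n\}$$ of closures in $\mathbb{R}^n$ of these sets forms a complete (polyhedral) fan in $\mathbb{R}^n$.
   Context: $k$ is a field, $R=k[x_1,\dots,x_n]$, and $a_1,\dots,a_n$ are elements of an abelian group $(A,+)$. $\mathbb{N}$ contains $0$. Put $S_A=\mathbb{N}a_1+\cdots+\mathbb{N}a_n\subset A$ and $\deg(x^v)=v_1a_1+\cdots+v_na_n$ for $v\in\mathbb{N}^n$. For $s\in A$ let $R_s$ be the $k$-span of the monomials of degree $s$; this gives an $A$-grading $R=\bigoplus_{s\in S_A}R_s$. $R$ is positively graded if $R_0=k$ (equivalently $\dim_k R_s<\infty$ for all $s\in S_A$). For an ideal $J$, $J_s=J\cap R_s$, and $J$ is homogeneous if $J=\bigoplus_s J_s$. A subset $\Omega\subset S_A$ is truncating if for all $s,t\in S_A$, $s+t\in\Omega$ implies $s,t\in\Omega$. For a homogeneous ideal $J$ put $J_\Omega=\bigoplus_{s\in\Omega}J_s$. For $\omega\in\mathbb{R}^n$ and $f\neq 0$, $\operatorname{in}_\omega(f)$ is the sum of those terms $c_vx^v$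 of $f$ with $\omega\cdot v$ maximal, and $\operatorname{in}_\omega(I)$ is the ideal generated by $\{\operatorname{in}_\omega(f)\mid f\in I\setminus\{0\}\}$ (homogeneous for the $A$-grading if $I$ is). A complete fan in $\mathbb{R}^n$ is a finite collection of polyhedral cones, closed under taking faces, in which any two cones intersect in a common face, and whose union is $\mathbb{R}^n$. *)

(* Defs.v *)
From HB Require Import structures.
From mathcomp Require Import all_boot all_order all_algebra.
(* Importing [mpoly] after [normedtype] makes their grammars clash, hence this
   order of imports. *)
From mathcomp Require Import mpoly.
From mathcomp Require Import boolp classical_sets cardinality reals topology.

Set Implicit Arguments.
Unset Strict Implicit.
Unset Printing Implicit Defensive.

Import Order.TTheory GRing.Theory Num.Theory.
Import numFieldTopology.Exports.
Local Open Scope classical_set_scope.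
Local Open Scope ring_scope.

Section Grading.
Variables (k : fieldType) (n : nat) (A : zmodType) (a : 'I_n -> A).

Definition mondeg (m : 'X_{1..n}) : A := \sum_(i < n) a i *+ m i.

Definition degrees : set A := range mondeg.

(* The k-span of the monomials of degree s; it is {0} when s is not in
   [degrees]. *)
Definition graded_piece (s : A) : set {mpoly k[n]} :=
  [set f | forall m, m \in msupp f -> mondeg m = s].

Definition positively_graded : Prop :=
  graded_piece 0 = range (fun c : k => c%:MP).

Definition truncating (Omega : set A) : Prop :=
  Omega `<=` degrees /\
  forall s t, degrees s -> degrees t -> Omega (s + t) -> Omega s /\ Omega t.

(* J_Omega, the sum over s in Omega of the J_s = J `&` R_s, as an internal sum:
   the finite sums of elements of these pieces.  It is direct because the R_s
   are independent. *)
Definition truncation (Omega : set A) (J : set {mpoly k[n]}) :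
    set {mpoly k[n]} :=
  [set f | exists2 gs : seq {mpoly k[n]},
     forall g, g \in gs -> exists2 s, Omega s & (J `&` graded_piece s) g
     & f = \sum_(g <- gs) g].

Definition homogeneous (J : set {mpoly k[n]}) : Prop :=
  J = truncation degrees J.

End Grading.

(* Not [idealr], which only covers proper ideals: here I may be the unit
   ideal. *)
Definition is_ideal (P : comNzRingType) (J : set P) : Prop :=
  [/\ J 0, forall f g, J f -> J g -> J (f + g)
    & forall h f, J f -> J (h * f)].

Section Initial.
Variables (k : fieldType) (R : realType) (n : nat).
Implicit Types (w : 'rV[R]_n) (I : set {mpoly k[n]}).

Definition weight w (m : 'X_{1..n}) : R := \sum_(i < n) w 0 i * (m i)%:R.

Definition initial_form w (f : {mpoly k[n]}) : {mpoly k[n]} :=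
  \sum_(m <- msupp f | all (fun m' => weight w m' <= weight w m) (msupp f))
     f@_m *: 'X_[m].

Definition initial_ideal w I : set {mpoly k[n]} :=
  smallest (@is_ideal {mpoly k[n]}) (initial_form w @` (I `\ 0)).

Variables (A : zmodType) (a : 'I_n -> A).

Definition truncated_class (Omega : set A) I w : set 'rV[R]_n :=
  [set v | truncation a Omega (initial_ideal v I)
           = truncation a Omega (initial_ideal w I)].

Definition truncated_groebner_fan (Omega : set A) I : set (set 'rV[R]_n) :=
  range (fun w => closure (truncated_class Omega I w)).

End Initial.

Arguments truncated_groebner_fan {k} R {n A} a Omega I.

Section Fans.
Variables (R : realType) (n : nat).
Implicit Types C D : set 'rV[R]_n.

Definition dotv (u x : 'rV[R]_n) : R := \sum_(i < n) u 0 i * x 0 i.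

Definition polyhedral_cone C : Prop :=
  exists r (M : 'M[R]_(r, n)), C = [set x | forall i, 0 <= dotv (row i M) x].

(* Faces of a cone are cut out by linear forms nonnegative on it: they include
   the cone itself (u = 0) and exclude the empty set. *)
Definition face_of D C : Prop :=
  exists2 u : 'rV[R]_n,
    forall x, C x -> 0 <= dotv u x & D = C `&` [set x | dotv u x = 0].

Definition complete_fan (F : set (set 'rV[R]_n)) : Prop :=
  [/\ finite_set F,
      forall C, F C -> polyhedral_cone C,
      forall C D, F C -> face_of D C -> F D,
      forall C D, F C -> F D -> face_of (C `&` D) C /\ face_of (C `&` D) D
    & \bigcup_(C in F) C = setT].

End Fans.

(* Main.v *)
Require Import Defs.
From HB Require Import structures.
From mathcomp Require Import all_boot all_order all_algebra.
From mathcomp Require Import perm lra mpoly.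
From mathcomp Require Import boolp classical_sets cardinality reals topology.

Set Implicit Arguments.
Unset Strict Implicit.
Unset Printing Implicit Defensive.

Import Order.TTheory GRing.Theory Num.Theory.
Import numFieldTopology.Exports.
Local Open Scope classical_set_scope.
Local Open Scope ring_scope.

(** The truncated classes are the relatively open cones of the normal fan of a
   polytope, the state polytope of the ideal.

   The truncation is disposed of first.  As [Omega] is truncating, the monomials
   with degree outside [Omega] span an ideal; adding it to [I] gives a
   homogeneous ideal [J] such that the truncations of the initial ideals of [I]
   for two weights agree if and only if the initial ideals of [J] do
   ([truncated_class_saturation]).  Throughout, the initial ideal is described
   one weight at a time ([graded_initial], [initial_idealE]), which makes it
   visibly a graded subspace, compatible with the grading by degrees.

   Next, finitely many degrees decide.  With a fixed monomial order breaking
   ties, every weight has an ideal of leading monomials of [J]; an induction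
   resting on Dickson's lemma gives finitely many monomials that contain
   generators of all these ideals ([uniform_leads]).  Weights may be negative, so
   the order refined by a weight need not be a well-order: division terminates
   because the positive grading has finite graded pieces ([finite_degree]).
   Hence there is a finite set of monomials, a union of graded pieces, on which
   the initial ideals of [J] determine one another ([finite_determinacy]).

   What remains is linear algebra in the space [V] of the elements of [J]
   supported on that finite set.  Call monomials, as many as the dimension of
   [V], a basis if the corresponding minor of a matrix of [V] is nonzero.  The
   bases of the initial space of [V] are the bases of [V] with maximal total
   weight, and they determine the initial space ([eq_initial_space]).  So two
   weights give the same initial ideal exactly when they are maximized by the
   same points among the sums of the exponents of the bases
   ([graded_initial_maximizers]), and the closures of the classes of this relation
   are the cones of the normal fan of these points ([complete_normal_fan]). *)

(** * Dickson's lemma and graded pieces *)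

Lemma nondecreasing_subsequence (g : nat -> nat) :
  exists2 phi : nat -> nat, {homo phi : p q / (p < q)%N} &
    {homo g \o phi : p q / (p <= q)%N}.
Proof.
have tail_min N : exists k, (N <= k)%N /\ forall l, (N <= l)%N -> (g k <= g l)%N.
  have ex : exists v, `[< exists2 k, (N <= k)%N & g k = v >].
    by exists (g N); apply/asboolP; exists N.
  case: (ex_minnP ex) => v /asboolP[k Nk <-] vmin.
  exists k; split=> // l Nl; apply: vmin.
  by apply/asboolP; exists l.
have [c cP] := choice tail_min.
(* [c N] is a position of the minimum of [g] over the indices from [N] on. *)
pose phi := fix phi p := if p is p'.+1 then c (phi p').+1 else c 0%N.
have phiS p : (phi p < phi p.+1)%N by have [] := cP (phi p).+1.
exists phi; first exact: (homo_ltn ltn_trans).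
apply: (homo_leq leqnn leq_trans) => p /=.
have mono : exists N, phi p = c N /\ (N <= phi p)%N.
  case: p => [|p] /=; first by exists 0%N.
  by exists (phi p).+1; split=> //; have [] := cP (phi p).+1.
have [N [phip Np]] := mono.
rewrite phip; have [_] := cP N; apply.
by rewrite -phip; apply: leq_trans Np (ltnW (phiS p)).
Qed.

(** Dickson's lemma, by extracting subsequences that are nondecreasing in one
   coordinate after the other. *)
Lemma dickson n (u : nat -> 'X_{1..n}) :
  exists i j, (i < j)%N /\ (u i <= u j)%MM.
Proof.
suff [phi phi_incr phi_mono] : exists2 phi : nat -> nat,
    {homo phi : p q / (p < q)%N} &
    forall i, i \in enum 'I_n -> {homo (fun p => u (phi p) i) : p q / (p <= q)%N}.
  exists (phi 0%N), (phi 1%N); split; first exact: phi_incr.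
  by apply/mnm_lepP => i; apply: (phi_mono i) => //; rewrite mem_enum.
elim: (enum 'I_n) => [|i s [phi phi_incr phi_mono]]; first by exists id.
have [psi psi_incr psi_mono] := nondecreasing_subsequence (fun p => u (phi p) i).
exists (phi \o psi) => [p q pq|j]; first exact/phi_incr/psi_incr.
rewrite inE => /predU1P[-> //|js] p q pq /=.
apply: phi_mono => //.
by apply: (homo_leq leqnn leq_trans _ pq) => r; apply/ltnW/psi_incr.
Qed.

Definition mdivisible n (J : seq 'X_{1..n}) (m : 'X_{1..n}) : bool :=
  has (fun j => (j <= m)%MM) J.

(** Dickson's lemma as an induction principle on monomial ideals, each given by
   a list of generators: a property holds as soon as it is inherited from all
   the ideals with one more generator. *)
Lemma dickson_ind n (P : seq 'X_{1..n} -> Prop) :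
  (forall J, (forall m, ~~ mdivisible J m -> P (m :: J)) -> P J) -> P [::].
Proof.
move=> step; apply: contrapT => nP0.
have ext (J : {J | ~ P J}) : exists m, ~~ mdivisible (sval J) m /\ ~ P (m :: sval J).
  apply: contrapT => noext; case: J noext => J nPJ /= noext; apply: nPJ.
  apply: step => m mJ; apply: contrapT => nPm; apply: noext.
  by exists m.
have [c cP] := choice ext.
pose next (J : {J | ~ P J}) : {J | ~ P J} :=
  exist (fun J => ~ P J) (c J :: sval J) (proj2 (cP J)).
pose J_ i := iter i next (exist (fun J => ~ P J) [::] nP0).
have memJ i j : (i < j)%N -> c (J_ i) \in sval (J_ j).
  elim: j => // j IHj; rewrite ltnS leq_eqVlt => /predU1P[->|/IHj mem_ij] /=.
    by rewrite inE eqxx.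
  by rewrite inE mem_ij orbT.
have [i [j [ij le_ij]]] := dickson (fun i => c (J_ i)).
have [+ _] := cP (J_ j); move/hasPn/(_ _ (memJ _ _ ij)).
by rewrite le_ij.
Qed.

Section Degrees.
Variables (n : nat) (A : zmodType) (a : 'I_n -> A).

Lemma mondegD m1 m2 : mondeg a (m1 + m2)%MM = mondeg a m1 + mondeg a m2.
Proof.
by rewrite /mondeg -big_split; apply: eq_bigr => i _; rewrite mnmDE mulrnDr.
Qed.

Variable k : fieldType.
Hypothesis posA : positively_graded k a.

Lemma mondeg_eq0 m : mondeg a m = 0 -> m = 0%MM.
Proof.
move=> m0; have : graded_piece a 0 ('X_[m] : {mpoly k[n]}).
  by move=> m'; rewrite msuppX inE => /eqP->.
rewrite posA => -[c _] /(congr1 (mcoeff m)).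
rewrite mcoeffC mcoeffX eqxx; case: eqP => //= _ /eqP.
by rewrite mulr0 eq_sym oner_eq0.
Qed.

(** Two monomials of the same degree do not divide one another, so by Dickson
   there are only finitely many of them. *)
Lemma finite_degree s : exists E : seq 'X_{1..n}, forall m, (m \in E) = (mondeg a m == s).
Proof.
suff : (forall m, m \in [::] -> mondeg a m = s) -> exists E : seq 'X_{1..n},
    forall m, (m \in E) = (mondeg a m == s) by apply.
apply: (@dickson_ind n (fun J => (forall m, m \in J -> mondeg a m = s) -> _)).
move=> J IHJ Js.
have [[m [mJ ms]]|noext] := EM (exists m, ~~ mdivisible J m /\ mondeg a m = s).
  by apply: (IHJ m) => // m'; rewrite inE => /predU1P[->//|/Js].
exists J => m; apply/idP/eqP => [/Js//|ms].
have /hasP[j jJ jm] : mdivisible J m.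
  by apply: contrapT => /negP mJ; apply: noext; exists m.
suff -> : m = j by [].
have /eqP := ms; rewrite -(submK jm) mondegD (Js j jJ).
by rewrite -[X in _ == X]add0r (inj_eq (addIr _)) => /eqP/mondeg_eq0 ->; rewrite add0m.
Qed.

End Degrees.

(** * The normal fan of a finite set of points *)

Section Dot.
Variables (R : realType) (n : nat).
Implicit Types (x y u : 'rV[R]_n).

Lemma dotvC x y : dotv x y = dotv y x.
Proof. by apply: eq_bigr => i _; rewrite mulrC. Qed.

Lemma dotv_linear u : linear_for *%R (dotv u).
Proof.
move=> c x y; rewrite /dotv mulr_sumr -big_split; apply: eq_bigr => i _.
by rewrite !mxE mulrDr mulrCA.
Qed.

HB.instance Definition _ u :=
  GRing.isLinear.Build R 'rV[R]_n R *%R (dotv u) (dotv_linear u).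

End Dot.

(** One [e] is small enough for finitely many strict inequalities at once: all
   the perturbation arguments below use it. *)
Lemma small_multiple (R : realType) (T : finType) (c d : T -> R) :
  exists2 e, 0 < e & forall t, 0 < c t -> e * d t <= c t.
Proof.
pose s := \sum_(t | 0 < c t) `|d t| / c t.
have s_ge0 : 0 <= s by apply: sumr_ge0 => t /ltW ct; rewrite divr_ge0.
have s1 : 0 < 1 + s by rewrite ltr_pwDl.
exists (1 + s)^-1 => [|t ct]; first by rewrite invr_gt0.
rewrite mulrC ler_pdivrMr //; apply: le_trans (ler_norm _) _.
rewrite -ler_pdivrMl // mulrC (le_trans _ (_ : s <= _)) ?lerDr //.
rewrite /s (bigD1 t) //= lerDl.
by apply: sumr_ge0 => t' /andP[/ltW ct' _]; rewrite divr_ge0.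
Qed.

Section NormalFan.
Variables (R : realType) (n : nat) (T : finType) (B : {set T}).
Variable p : T -> 'rV[R]_n.
Implicit Types (x y w : 'rV[R]_n) (S : {set T}).

Definition maximizers x : {set T} :=
  [set g in B | [forall (g' | g' \in B), dotv x (p g') <= dotv x (p g)]]%SET.

Lemma maximizersP x g : reflect
  (g \in B /\ forall g', g' \in B -> dotv x (p g') <= dotv x (p g))
  (g \in maximizers x).
Proof.
rewrite inE; apply: (iffP andP) => -[gB gmax]; split=> //.
  by move=> g' g'B; move/forall_inP: gmax; apply.
by apply/forall_inP.
Qed.

Lemma maximizers_eq x g g' :
  g \in maximizers x -> g' \in maximizers x -> dotv x (p g) = dotv x (p g').
Proof.
move=> /maximizersP[gB gx] /maximizersP[g'B g'x].
by apply/eqP; rewrite eq_le gx // g'x.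
Qed.

(** A point maximizing both forms reaches the sum of the two maxima, so the
   maximizers of the sum have to reach each maximum. *)
Lemma maximizersD x y e : 0 < e -> (maximizers x :&: maximizers y)%SET != finset.set0 ->
  maximizers (e *: x + y) = (maximizers x :&: maximizers y)%SET.
Proof.
move=> e0 /finset.set0Pn[h /finset.setIP[hx hy]].
have lin z : dotv (e *: x + y) z = e * dotv x z + dotv y z.
  by rewrite dotvC linearP /= !(dotvC z).
apply/finset.setP => g; rewrite finset.in_setI; apply/idP/andP => [|[]].
  move=> /maximizersP[gB]; have [hB hx'] := maximizersP _ _ hx.
  have [_ hy'] := maximizersP _ _ hy.
  move=> /(_ h hB); rewrite !lin => le_hg.
  have le_x := hx' g gB; have le_y := hy' g gB.
  have eq_y : dotv y (p g) = dotv y (p h).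
    apply/eqP; rewrite eq_le le_y; rewrite -(ler_pM2l e0) in le_x; lra.
  have eq_x : dotv x (p g) = dotv x (p h).
    by apply/eqP; rewrite eq_le le_x -(ler_pM2l e0); lra.
  by split; apply/maximizersP; split=> // g'; rewrite ?eq_x ?eq_y; auto.
move=> /maximizersP[gB gx] /maximizersP[_ gy]; apply/maximizersP; split=> //.
by move=> g' g'B; rewrite !lin lerD ?gy // ler_pM2l // gx.
Qed.

(** When [S] consists of the maximizers of some form, this is the closed normal
   cone of the face of the polytope on which that form is maximal. *)
Definition normal_cone S : set 'rV[R]_n := [set x | S \subset maximizers x].

Hypothesis B0 : B != finset.set0.

Lemma maximizers_neq0 x : maximizers x != finset.set0.
Proof.
have [g0 g0B] := finset.set0Pn _ B0.
case: (arg_maxP (fun g => dotv x (p g)) g0B) => g gB gmax.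
by apply/finset.set0Pn; exists g; apply/maximizersP; split=> // g' /gmax.
Qed.

(** Moving from [w] in the direction opposite to [x] creates no new maximizer for
   a short while, and loses none because [x] is constant on those of [w]. *)
Lemma maximizers_perturb w x :
  maximizers w \subset maximizers x ->
  exists2 e, 0 < e & maximizers w \subset maximizers (w - e *: x).
Proof.
move=> /fintype.subsetP wx.
have [e e0 eP] := small_multiple
  (fun gg : T * T => dotv w (p gg.1) - dotv w (p gg.2))
  (fun gg => dotv x (p gg.1) - dotv x (p gg.2)).
exists e => //; apply/fintype.subsetP => g gw.
have lin z : dotv (w - e *: x) z = dotv w z - e * dotv x z.
  by rewrite dotvC linearB linearZ /= !(dotvC z).
have [gB gmax] := maximizersP _ _ gw.
apply/maximizersP; split=> // g' g'B; rewrite !lin.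
have [g'w|g'w] := boolP (g' \in maximizers w).
  by rewrite (maximizers_eq gw g'w) (maximizers_eq (wx _ gw) (wx _ g'w)).
have /(eP (g, g')) /= : 0 < dotv w (p g) - dotv w (p g').
  rewrite subr_gt0 lt_neqAle gmax // andbT; apply: contra g'w => /eqP eq_gg'.
  by apply/maximizersP; rewrite eq_gg'; split.
by lra.
Qed.

(** If [x] lies in the closed cone of [w], then [x + d *: w] has exactly the
   maximizers of [w] for every [d > 0], so [x] is a limit of such points. *)
Lemma closure_maximizers w :
  closure [set v | maximizers v = maximizers w] = normal_cone (maximizers w).
Proof.
apply/seteqP; split=> x.
  move=> clx; apply/fintype.subsetP => g gw.
  have [gB gmax] := maximizersP _ _ gw.
  apply/maximizersP; split=> // g' g'B; rewrite -subr_le0 -linearB /=.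
  set q := p g' - p g; rewrite leNgt; apply/negP => xq0.
  have [e e0 /(_ tt xq0) le_e] :=
    small_multiple (fun _ : unit => dotv x q) (fun=> 1 + \sum_i `|q 0 i|).
  have [y [yw xy]] := clx _ (nbhsx_ballx x e e0).
  have yq : dotv y q <= 0.
    rewrite linearB subr_le0 /=.
    by move: gw; rewrite -yw => /maximizersP[_]; apply.
  have : dotv x q - dotv y q <= e * \sum_i `|q 0 i|.
    rewrite /dotv -sumrB mulr_sumr; apply: ler_sum => i _.
    rewrite -mulrBl; apply: le_trans (ler_norm _) _; rewrite normrM.
    apply: ler_wpM2r => //; apply: ltW. by case: xy => _; apply.
  by move: le_e; rewrite mulrDr mulr1; lra.
move=> xw U /nbhs_ballP[e /= e0 eU].
have [d d0 dP] := small_multiple (fun _ : 'I_n => e / 2) (fun i => `|w 0 i|).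
exists (d *: w + x); split.
  have /finset.setIidPl wI := xw.
  by rewrite /= maximizersD // wI // maximizers_neq0.
apply: eU; split=> // i j; rewrite ord1 /ball /= !mxE opprD addrCA subrr addr0 normrN.
rewrite normrM gtr0_norm // (le_lt_trans (dP j _)) ?divr_gt0 //.
by rewrite ltr_pdivrMr // mulr_natr mulr2n ltrDl.
Qed.

Lemma polyhedral_normal_cone S : S \subset B -> polyhedral_cone (normal_cone S).
Proof.
move=> /fintype.subsetP SB.
pose q (gg : T * T) := if (gg.1 \in S) && (gg.2 \in B) then p gg.1 - p gg.2 else 0.
exists #|{: T * T}|, (\matrix_i q (enum_val i)).
apply/seteqP; split=> x.
  move=> /fintype.subsetP Sx i; rewrite rowK /q.
  case: ifP => [/andP[/Sx/maximizersP[_ gmax] g'B]|_]; last first.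
    by rewrite dotvC linear0.
  by rewrite dotvC linearB subr_ge0 gmax.
move=> xP; apply/fintype.subsetP => g gS; apply/maximizersP; split; first exact: SB.
move=> g' g'B; have := xP (enum_rank (g, g')).
by rewrite rowK enum_rankK /q /= gS g'B dotvC linearB subr_ge0.
Qed.

(** The face of a normal cone cut out by [u] is the normal cone of the
   maximizers of a point in its relative interior, that is a point of the face
   with as few maximizers as possible. *)
Lemma face_normal_cone D w : face_of D (normal_cone (maximizers w)) ->
  exists w', D = normal_cone (maximizers w').
Proof.
move=> [u u_ge0 DE].
have D0 : D 0.
  rewrite DE; split; last by rewrite /= linear0.
  apply/fintype.subsetP => g /maximizersP[gB _]; apply/maximizersP; split=> //.
  by move=> g' _; rewrite !(dotvC 0) !linear0.
have ex : exists N, `[< exists2 x, D x & #|maximizers x| = N >].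
  by exists #|maximizers 0|; apply/asboolP; exists 0.
case: (ex_minnP ex) => N /asboolP[w' Dw' <-] wmin; exists w'.
have /= [ww' uw'] : (normal_cone (maximizers w) `&` [set x | dotv u x = 0]) w'.
  by rewrite -DE.
apply/seteqP; split=> x.
  move=> Dx; have := Dx; rewrite {1}DE => -[/= wx ux].
  (* [x + w'] is in the face too, and minimality of [w'] forces all the
     maximizers of [w'] to be maximizers of [x]. *)
  have ne0 : (maximizers x :&: maximizers w')%SET != finset.set0.
    have [g gw] := finset.set0Pn _ (maximizers_neq0 w); apply/finset.set0Pn; exists g.
    by rewrite finset.in_setI (fintype.subsetP wx) // (fintype.subsetP ww').
  have maxD : maximizers (x + w') = (maximizers x :&: maximizers w')%SET.
    by rewrite -[x in LHS]scale1r maximizersD.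
  have DD : D (x + w').
    rewrite DE; split; last by rewrite /= linearD /= ux uw' addr0.
    by rewrite /normal_cone /= maxD finset.subsetI wx ww'.
  have /wmin : `[< exists2 y, D y & #|maximizers y| = #|maximizers (x + w')| >].
    by apply/asboolP; exists (x + w').
  rewrite maxD => le_card; apply/finset.setIidPr/eqP.
  by rewrite eqEcard finset.subsetIr.
move=> w'x; rewrite DE; split; first exact: fintype.subset_trans ww' w'x.
(* [w'] is interior: [w' - e *: x] still lies in the cone, so [u] cannot be
   positive on [x]. *)
have [e e0 ew'] := maximizers_perturb w'x.
have /u_ge0 : normal_cone (maximizers w) (w' - e *: x).
  exact: fintype.subset_trans ww' ew'.
rewrite linearB linearZ /= uw' sub0r oppr_ge0 pmulr_rle0 // => ux.
have ux' : 0 <= dotv u x by apply/u_ge0/fintype.subset_trans/w'x.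
by apply/eqP; rewrite eq_le ux.
Qed.

(** Two normal cones meet in the face of the first where the values attained on
   both sets of maximizers coincide; the sum of all the differences of such
   values is the linear form that cuts it out. *)
Lemma face_normal_coneI w w' :
  face_of (normal_cone (maximizers w) `&` normal_cone (maximizers w'))
    (normal_cone (maximizers w)).
Proof.
pose u := \sum_(g in maximizers w) \sum_(g' in maximizers w') (p g - p g').
have uE x : dotv u x =
    \sum_(g in maximizers w) \sum_(g' in maximizers w') (dotv x (p g) - dotv x (p g')).
  rewrite dotvC linear_sum; apply: eq_bigr => g _; rewrite linear_sum.
  by apply: eq_bigr => g' _; rewrite linearB.
have term_ge0 x : normal_cone (maximizers w) x -> forall g g',
    g \in maximizers w -> g' \in maximizers w' -> 0 <= dotv x (p g) - dotv x (p g').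
  move=> /fintype.subsetP wx g g' /wx/maximizersP[_ gmax] /maximizersP[g'B _].
  by rewrite subr_ge0 gmax.
exists u => [x wx|].
  rewrite uE; apply: sumr_ge0 => g gw; apply: sumr_ge0 => g' g'w.
  exact: term_ge0.
apply/seteqP; split=> x [wx].
  move=> w'x; split=> //=; rewrite uE big1 // => g gw; rewrite big1 // => g' g'w.
  by apply/eqP; rewrite subr_eq0; apply/eqP/maximizers_eq;
    [apply: (fintype.subsetP wx)|apply: (fintype.subsetP w'x)].
move=> /= /eqP; rewrite uE psumr_eq0 => [/allP all0|g gw]; last first.
  by apply: sumr_ge0 => g' g'w; apply: term_ge0.
split=> //; apply/fintype.subsetP => g' g'w.
have [g gw] := finset.set0Pn _ (maximizers_neq0 w).
have := all0 g (mem_index_enum g); rewrite gw /=.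
rewrite psumr_eq0 => [/allP|? ?]; last exact: term_ge0.
move=> /(_ g' (mem_index_enum g')); rewrite g'w subr_eq0 /= => /eqP eq_gg'.
have /maximizersP[_ gmax] := fintype.subsetP wx _ gw.
by have [g'B _] := maximizersP _ _ g'w; apply/maximizersP; rewrite -eq_gg'.
Qed.

(** This is the normal fan of the convex hull of the points [p g]. *)
Lemma complete_normal_fan :
  complete_fan (range (fun w => closure [set v | maximizers v = maximizers w])).
Proof.
under [X in range X]boolp.eq_fun do rewrite closure_maximizers.
split.
- apply: (@sub_finite_set _ _ (normal_cone @` [set: {set T}])).
    by move=> _ [w _ <-]; exists (maximizers w).
  exact/finite_image/finite_finset.
- move=> _ [w _ <-]; apply: polyhedral_normal_cone.
  by apply/fintype.subsetP => g /maximizersP[].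
- by move=> _ D [w _ <-] /face_normal_cone[w' ->]; exists w'.
- move=> _ _ [w _ <-] [w' _ <-]; split; first exact: face_normal_coneI.
  by rewrite setIC; apply: face_normal_coneI.
- apply/seteqP; split=> // x _; exists (normal_cone (maximizers x)) => //.
  exact: fintype.subxx.
Qed.

End NormalFan.

(** * Initial spaces of a subspace of a coordinate space *)

Section LinearSets.
Variables (k : fieldType) (N : nat).

(** Passing from a predicate to a matrix: take a matrix of maximal rank among
   those whose rows all satisfy the predicate. *)
Lemma linear_set_basis (S : set 'rV[k]_N) :
  S 0 -> (forall c x y, S x -> S y -> S (c *: x + y)) ->
  exists d (M : 'M[k]_(d, N)), row_free M /\ forall x, S x <-> (x <= M)%MS.
Proof.
move=> S0 Slin.
have SD x y : S x -> S y -> S (x + y) by move=> Sx; rewrite -[x]scale1r; apply: Slin.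
have SZ c x : S x -> S (c *: x) by move=> Sx; rewrite -[_ *: _]addr0; apply: Slin.
pose good r := exists M : 'M[k]_N, \rank M = r /\ forall x, (x <= M)%MS -> S x.
have ex : exists r, `[< good r >].
  exists 0%N; apply/asboolP; exists 0; rewrite mxrank0; split=> // x.
  by rewrite submx0 => /eqP->.
have bnd r : `[< good r >] -> (r <= N)%N.
  by move=> /asboolP[M [<- _]]; apply: rank_leq_row.
case: (ex_maxnP ex bnd) => _ /asboolP[M [<- MS]] maxM.
exists (\rank M), (row_base M); split; first exact: row_base_free.
move=> x; rewrite eq_row_base; split=> [Sx|]; last exact: MS.
have rank_sub := geq_leqif (mxrank_leqif_sup (addsmxSl M x)).
move: rank_sub; rewrite addsmx_sub submx_refl /= => <-.
apply: maxM; apply/asboolP; exists (M + x)%MS; split=> //.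
move=> _ /sub_addsmxP[[u v] ->] /=; apply: SD; first by apply/MS/submxMl.
by rewrite [v]mx11_scalar mul_scalar_mx; apply: SZ.
Qed.

End LinearSets.

Section InitialSpace.
Variables (k : fieldType) (R : realType) (d N : nat) (M : 'M[k]_(d, N)).
Hypothesis freeM : row_free M.
Implicit Types (w : 'I_N -> R) (g h : {ffun 'I_d -> 'I_N}).

(** For a subspace [S], this is the span of the top-weight parts of its vectors,
   where the [i]-th coordinate has weight [w i]: the span is graded by the weight,
   and each of its components consists of top-weight parts and zero. *)
Definition initial_space w (S : set 'rV[k]_N) : set 'rV[k]_N :=
  [set y | forall W, exists x, [/\ S x, forall i, x 0 i != 0 -> w i <= W
                             & forall i, w i = W -> x 0 i = y 0 i]].

(** The bases of the matroid of the columns of [M], as sequences of columns: this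
   lets minors be written with [colsub], at the price of repeating each basis in
   all its orderings. *)
Definition col_bases : {set {ffun 'I_d -> 'I_N}} :=
  [set g : {ffun 'I_d -> 'I_N} | colsub g M \in unitmx]%SET.

Definition col_weight w g : R := \sum_b w (g b).

Definition optimal_bases w : {set {ffun 'I_d -> 'I_N}} :=
  [set g in col_bases |
     [forall (h | h \in col_bases), col_weight w h <= col_weight w g]]%SET.

Lemma optimal_basesP w g : reflect
  (g \in col_bases /\ forall h, h \in col_bases -> col_weight w h <= col_weight w g)
  (g \in optimal_bases w).
Proof.
rewrite [_ \in optimal_bases _]inE; apply: (iffP andP) => -[gB gmax]; split=> //.
  by move=> h hB; move/forall_inP: gmax; apply.
by apply/forall_inP.
Qed.

Lemma col_bases_neq0 : col_bases != finset.set0.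
Proof.
have fullMT : row_full M^T by rewrite /row_full mxrank_tr.
apply/finset.set0Pn; exists (fullrankfun fullMT); rewrite inE -unitmx_tr.
have -> : (colsub (fullrankfun fullMT) M)^T = rowsub (fullrankfun fullMT) M^T.
  by apply/matrixP => i j; rewrite !mxE.
exact: fullrowsub_unit.
Qed.

Lemma optimal_bases_neq0 w : optimal_bases w != finset.set0.
Proof.
have [g0 g0B] := finset.set0Pn _ col_bases_neq0.
case: (arg_maxP (col_weight w) g0B) => g gB gmax.
by apply/finset.set0Pn; exists g; apply/optimal_basesP; split=> // h /gmax.
Qed.

(** The basis of the row space of [M] that is dual to the coordinates [g].  It is
   locked so that rewriting with [mxE] does not expand its entries. *)
Definition dual_basis g : 'M[k]_(d, N) :=
  locked (invmx (colsub g M) *m M).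

Definition exchange g b j : {ffun 'I_d -> 'I_N} :=
  [ffun i => if i == b then j else g i].

(** The top-weight parts of the rows of [dual_basis g], provided that [g] is
   optimal: then [g b] has the largest weight in row [b]. *)
Definition initial_basis w g : 'M[k]_(d, N) :=
  \matrix_(b, j) if w j == w (g b) then dual_basis g b j else 0.

Section Basis.
Variable g : {ffun 'I_d -> 'I_N}.
Hypothesis gB : g \in col_bases.
Let unit_g : colsub g M \in unitmx. Proof. by move: gB; rewrite inE. Qed.

Lemma colsub_dual_basis h : colsub h M = colsub g M *m colsub h (dual_basis g).
Proof. by rewrite /dual_basis -lock mulmx_colsub mulmxA mulmxV // mul1mx. Qed.

Lemma dual_basisE b i : dual_basis g b (g i) = (b == i)%:R.
Proof.
have : colsub g (dual_basis g) = 1%:M.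
    by rewrite /dual_basis -lock -mulmx_colsub mulVmx.
by move=> /matrixP/(_ b i); rewrite !mxE.
Qed.

Lemma col_bases_dual h : (h \in col_bases) = (\det (colsub h (dual_basis g)) != 0).
Proof. by rewrite inE (colsub_dual_basis h) unitmx_mul unit_g unitmxE unitfE. Qed.

Lemma sub_dual_basis (x : 'rV[k]_N) :
  (x <= M)%MS <-> forall j, x 0 j = \sum_b x 0 (g b) * dual_basis g b j.
Proof.
have <- : (x <= dual_basis g)%MS = (x <= M)%MS.
  by rewrite /dual_basis -lock eqmxMfull // row_full_unit unitmx_inv.
split=> [/submxP[c ->] j|xE]; last first.
  apply/submxP; exists (\row_b x 0 (g b)); apply/rowP => j; rewrite xE mxE.
  by apply: eq_bigr => b _; rewrite [in RHS]mxE.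
rewrite [LHS]mxE; apply: eq_bigr => b _; rewrite [X in _ = X * _]mxE (bigD1 b) //=.
rewrite dual_basisE eqxx mulr1 big1 ?addr0 // => i ib.
by rewrite dual_basisE (negPf ib) mulr0.
Qed.

Lemma exchange_basis b j : dual_basis g b j != 0 -> exchange g b j \in col_bases.
Proof.
move=> nz; rewrite inE colsub_dual_basis unitmx_mul unit_g -row_free_unit /=.
apply: inj_row_free => v v0.
have vE i : \sum_l v 0 l * dual_basis g l (exchange g b j i) = 0.
  move/rowP/(_ i): v0; rewrite !mxE => v0; rewrite -[RHS]v0.
  by apply: eq_bigr => l _; rewrite [in RHS]mxE.
have v_neq i : i != b -> v 0 i = 0.
  move=> ib; have := vE i; rewrite ffunE (negPf ib) (bigD1 i) //= dual_basisE eqxx.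
  rewrite mulr1 big1 ?addr0 // => l li; by rewrite dual_basisE (negPf li) mulr0.
apply/rowP => i; rewrite [RHS]mxE; have [->|/v_neq//] := eqVneq i b.
have := vE b; rewrite ffunE eqxx (bigD1 b) //= big1 ?addr0 => [|l /v_neq->]; last first.
  by rewrite mul0r.
by move=> /eqP; rewrite mulf_eq0 (negPf nz) orbF => /eqP.
Qed.

Lemma col_weight_exchange w b j :
  col_weight w (exchange g b j) = col_weight w g + (w j - w (g b)).
Proof.
rewrite /col_weight (bigD1 b) //= [in RHS](bigD1 b) //= ffunE eqxx.
rewrite (eq_bigr (fun i => w (g i))) => [|i /negPf ib]; last by rewrite ffunE ib.
by rewrite addrC [in RHS](addrC (w (g b))) -addrA (addrC (w (g b))) subrK.
Qed.

End Basis.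

Section Optimal.
Variables (w : 'I_N -> R) (g : {ffun 'I_d -> 'I_N}).
Hypothesis g_opt : g \in optimal_bases w.
Let gB : g \in col_bases. Proof. by have [] := optimal_basesP _ _ g_opt. Qed.

(** Otherwise an exchange would increase the weight of [g]. *)
Lemma dual_basis_le b j : dual_basis g b j != 0 -> w j <= w (g b).
Proof.
move=> /(exchange_basis gB) hB.
have [_ /(_ _ hB)] := optimal_basesP _ _ g_opt.
by rewrite col_weight_exchange gerDl subr_le0.
Qed.

Lemma optimal_eq_weight h : h \in col_bases ->
  (h \in optimal_bases w) = (col_weight w h == col_weight w g).
Proof.
move=> hB; have [_ gmax] := optimal_basesP _ _ g_opt.
apply/idP/eqP => [/optimal_basesP[_ hmax]|hg].
  by apply/eqP; rewrite eq_le gmax ?hmax.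
by apply/optimal_basesP; rewrite hg; split.
Qed.

Lemma exchange_optimal b j : dual_basis g b j != 0 ->
  (exchange g b j \in optimal_bases w) = (w j == w (g b)).
Proof.
move=> nz; rewrite optimal_eq_weight ?exchange_basis // col_weight_exchange.
by rewrite -subr_eq0 addrAC subrr add0r subr_eq0.
Qed.

(** Expand a vector in the dual basis: its coefficients are its coordinates at
   [g], so no row of weight above the top weight of the vector occurs. *)
Lemma initial_spaceE (y : 'rV[k]_N) :
  initial_space w [set x : 'rV[k]_N | (x <= M)%MS] y <-> (y <= initial_basis w g)%MS.
Proof.
split=> [y_in|/submxP[c ->] W].
  apply/submxP; exists (\row_b y 0 (g b)); apply/rowP => j; rewrite mxE.
  have [x [/= /(sub_dual_basis gB) xE x_le x_eq]] := y_in (w j).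
  rewrite -x_eq // xE; apply: eq_bigr => b _; rewrite !mxE.
  have [jb|jb] := eqVneq (w j) (w (g b)); first by rewrite x_eq.
  rewrite mulr0; apply/eqP; rewrite mulf_eq0; apply/negPn/negP.
  rewrite negb_or => /andP[/x_le le_b /dual_basis_le le_j].
  by move: jb; rewrite eq_le le_b le_j.
exists (\sum_(b | w (g b) == W) c 0 b *: row b (dual_basis g)); split=> /=.
- apply: summx_sub => b _; apply: scalemx_sub; rewrite /dual_basis -lock.
  exact: submx_trans (row_sub _ _) (submxMl _ _).
- move=> i; apply: contraNT => iW; rewrite summxE big1 // => b /eqP bW.
  rewrite !mxE; apply/eqP; rewrite mulf_eq0; apply/orP; right.
  by apply: contraNT iW => /dual_basis_le; rewrite bW.
- move=> i iW; rewrite summxE mxE big_mkcond; apply: eq_bigr => b _.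
  by rewrite !mxE iW [W == _]eq_sym; case: ifP => // _; rewrite mulr0.
Qed.

(** In the expansion of a maximal minor of [dual_basis g], every nonzero term
   indexed by [s] pairs each [g b] with a column [h (s b)] of at most the same
   weight.  The terms surviving in [initial_basis w g] are those for which all
   of these weights are equal, which can only happen, and then happens for all
   the nonzero terms at once, if [h] has the same total weight as [g]. *)
Lemma unit_initial_basis h :
  (colsub h (initial_basis w g) \in unitmx) = (h \in optimal_bases w).
Proof.
pose wt (s : {perm 'I_d}) b := w (h (s b)).
have sum_wt s : \sum_b wt s b = col_weight w h.
  by rewrite /col_weight [RHS](reindex_inj (@perm_inj _ s)).
have termE (s : {perm 'I_d}) :
    \prod_b colsub h (initial_basis w g) b (s b) =
    if col_weight w h == col_weight w g
    then \prod_b colsub h (dual_basis g) b (s b) else 0.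
  have [/forallP all_eq|/forallPn[b nb]] := boolP [forall b, wt s b == w (g b)].
    have -> : col_weight w h = col_weight w g.
      by rewrite -(sum_wt s); apply: eq_bigr => b _; apply/eqP.
    rewrite eqxx; apply: eq_bigr => b _; rewrite 2![LHS]mxE -/(wt s b).
    by rewrite (eqP (all_eq b)) eqxx [RHS]mxE.
  rewrite (bigD1 b) //= [X in X * _]mxE mxE -/(wt s b) (negPf nb) mul0r.
  case: eqP => // eq_hg; apply/esym/eqP; apply: contraNT nb => nz.
  have le_wt i : wt s i <= w (g i).
    apply: dual_basis_le; apply: contra nz => /eqP z.
    by rewrite (bigD1 i) //= [X in X * _]mxE z mul0r.
  have : \sum_i (w (g i) - wt s i) == 0 by rewrite sumrB sum_wt eq_hg subrr.
  rewrite psumr_eq0 => [/allP/(_ b (mem_index_enum b))|i _]; last by rewrite subr_ge0.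
  by rewrite subr_eq0 eq_sym.
have detE : \det (colsub h (initial_basis w g)) =
    if col_weight w h == col_weight w g then \det (colsub h (dual_basis g)) else 0.
  rewrite /determinant; under eq_bigr do rewrite termE.
  by case: ifP => // _; rewrite big1 // => s _; rewrite mulr0.
rewrite unitmxE unitfE detE.
have [hB|hB] := boolP (h \in col_bases).
  by rewrite optimal_eq_weight //; case: ifP; rewrite ?eqxx // -col_bases_dual.
rewrite (_ : h \in optimal_bases w = false); last first.
  by apply: contraNF hB => /optimal_basesP[].
by move: hB; rewrite (col_bases_dual gB) negbK => /eqP->; rewrite if_same eqxx.
Qed.

End Optimal.

(** An entry of [dual_basis g] is kept in [initial_basis w g] exactly when the
   corresponding exchange is again optimal. *)
Lemma initial_basis_optimal w w' g :
  optimal_bases w = optimal_bases w' -> g \in optimal_bases w ->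
  initial_basis w g = initial_basis w' g.
Proof.
move=> eq_opt gw; have gw' : g \in optimal_bases w' by rewrite -eq_opt.
apply/matrixP => b j; rewrite !mxE.
have [->|nz] := eqVneq (dual_basis g b j) 0; first by rewrite !if_same.
by rewrite -(exchange_optimal gw nz) eq_opt (exchange_optimal gw' nz).
Qed.

(** The column bases of the initial space are the optimal bases of [M];
   conversely, one optimal basis and the optimal exchanges from it determine the
   initial space. *)
Lemma eq_initial_space w w' :
  initial_space w [set x : 'rV[k]_N | (x <= M)%MS] =
  initial_space w' [set x : 'rV[k]_N | (x <= M)%MS] <->
  optimal_bases w = optimal_bases w'.
Proof.
split=> [eq_in|eq_opt].
  have [g gw] := finset.set0Pn _ (optimal_bases_neq0 w).
  have [g' gw'] := finset.set0Pn _ (optimal_bases_neq0 w').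
  have /eqmxP eq_rows : (initial_basis w g == initial_basis w' g')%MS.
    apply/andP; split; apply/row_subP => i.
      by apply/(initial_spaceE gw'); rewrite -eq_in; apply/(initial_spaceE gw)/row_sub.
    by apply/(initial_spaceE gw); rewrite eq_in; apply/(initial_spaceE gw')/row_sub.
  apply/finset.setP => h; rewrite -(unit_initial_basis gw) -(unit_initial_basis gw').
  have [/submxP[X XE] /submxP[Y YE]] : (initial_basis w g <= initial_basis w' g')%MS
      /\ (initial_basis w' g' <= initial_basis w g)%MS by rewrite !eq_rows.
  apply/idP/idP => [|].
    by rewrite {1}XE -mulmx_colsub unitmx_mul => /andP[].
  by rewrite {1}YE -mulmx_colsub unitmx_mul => /andP[].
have [g gw] := finset.set0Pn _ (optimal_bases_neq0 w).
have gw' : g \in optimal_bases w' by rewrite -eq_opt.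
apply/seteqP; split=> y.
  move=> /(initial_spaceE gw).
  by rewrite (initial_basis_optimal eq_opt gw) => /(initial_spaceE gw').
move=> /(initial_spaceE gw').
by rewrite -(initial_basis_optimal eq_opt gw) => /(initial_spaceE gw).
Qed.

End InitialSpace.

(** * Initial ideals, their grading and their truncation *)

Section Restriction.
Variables (k : fieldType) (n : nat).
Implicit Types (f g : {mpoly k[n]}) (P : pred 'X_{1..n}).

Definition mrestrict P f : {mpoly k[n]} :=
  \sum_(m <- msupp f | P m) f@_m *: 'X_[m].

Lemma mcoeff_restrict P f m : (mrestrict P f)@_m = if P m then f@_m else 0.
Proof.
rewrite raddf_sum /=; under eq_bigr do rewrite mcoeffZ mcoeffX.
have [mf|mf] := boolP (m \in msupp f); last first.
  rewrite big1_seq ?memN_msupp_eq0 ?if_same // => m' /andP[_ m'f].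
  by case: eqP m'f mf => [->->//|]; rewrite mulr0.
rewrite big_mkcond (bigD1_seq m) ?msupp_uniq //= eqxx mulr1 big1 ?addr0 // => m' m'm.
by rewrite (negPf m'm) mulr0 if_same.
Qed.

Lemma mrestrict_is_linear P : linear (mrestrict P).
Proof.
move=> c f g; apply/mpolyP => m; rewrite mcoeffD mcoeffZ !mcoeff_restrict.
by case: ifP => _; rewrite ?mcoeffD ?mcoeffZ // mulr0 addr0.
Qed.

HB.instance Definition _ P := GRing.isLinear.Build k {mpoly k[n]} {mpoly k[n]} *:%R
  (mrestrict P) (mrestrict_is_linear P).

Lemma mrestrict_id P f : (forall m, f@_m != 0 -> P m) -> mrestrict P f = f.
Proof.
move=> fP; apply/mpolyP => m; rewrite mcoeff_restrict; case: ifP => // /negbT nP.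
by apply/esym/eqP; apply: contraNT nP => /fP.
Qed.

Lemma mrestrict0 P f : (forall m, f@_m != 0 -> ~~ P m) -> mrestrict P f = 0.
Proof.
move=> fP; apply/mpolyP => m; rewrite mcoeff_restrict mcoeff0; case: ifP => // Pm.
by apply/eqP; apply: contraTT Pm => /fP.
Qed.

(** Used both for the grading by degree and for the grading by weight. *)
Lemma sum_components (K : eqType) (key : 'X_{1..n} -> K) f :
  f = \sum_(s <- undup (map key (msupp f))) mrestrict (fun m => key m == s) f.
Proof.
apply/mpolyP => m; rewrite raddf_sum /=; under eq_bigr do rewrite mcoeff_restrict.
have [mf|mf] := boolP (m \in msupp f); last first.
  by rewrite memN_msupp_eq0 // big1 // => s _; rewrite if_same.
rewrite (bigD1_seq (key m)) ?undup_uniq ?mem_undup ?map_f //= eqxx.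
by rewrite big1 ?addr0 // => s; rewrite eq_sym => /negPf->.
Qed.

Lemma mcoeff_mulX c u f m : ((c *: 'X_[u]) * f)@_m =
  if (u <= m)%MM then c * f@_(m - u) else 0.
Proof.
rewrite -scalerAl mcoeffZ mulrC; case: ifP => [um|um].
  by rewrite -{1}(submK um) addmC (mulrC 'X_[u]) mcoeffMX mulrC.
rewrite (mulrC 'X_[u]) memN_msupp_eq0 ?mul0r //; apply/negP => /msuppM_le.
move=> /allpairsP[[m1 m2] /= [_]]; rewrite msuppX inE => /eqP-> m12.
by move: um; rewrite m12 lem_addl.
Qed.

End Restriction.

Section GradedInitial.
Variables (k : fieldType) (R : realType) (n : nat).
Implicit Types (w v : 'rV[R]_n) (f g : {mpoly k[n]}) (J : set {mpoly k[n]}).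

Lemma weightD w m1 m2 : weight w (m1 + m2)%MM = weight w m1 + weight w m2.
Proof.
by rewrite /weight -big_split; apply: eq_bigr => i _; rewrite mnmDE natrD mulrDr.
Qed.

(** For an ideal [J], this is the initial ideal described one weight at a time:
   its elements of weight [W] are the parts of weight [W] of the elements of [J]
   without monomials of larger weight.  Unlike the initial forms themselves, these
   parts are stable under addition. *)
Definition graded_initial w J : set {mpoly k[n]} :=
  [set g | forall W, exists f, [/\ J f, forall m, f@_m != 0 -> weight w m <= W
                             & forall m, weight w m = W -> f@_m = g@_m]].

Lemma mcoeff_initial_form w f m : (initial_form w f)@_m =
  if all (fun m' => weight w m' <= weight w m) (msupp f) then f@_m else 0.
Proof. exact: mcoeff_restrict. Qed.

Lemma is_ideal_sum J (T : eqType) (s : seq T) (F : T -> {mpoly k[n]}) :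
  is_ideal J -> (forall t, t \in s -> J (F t)) -> J (\sum_(t <- s) F t).
Proof.
move=> [J0 JD _] JF; rewrite big_seq; elim/big_ind: _ => //.
Qed.

Lemma is_idealZ J c f : is_ideal J -> J f -> J (c *: f).
Proof. by move=> [_ _ JM] /(JM c%:MP); rewrite mul_mpolyC. Qed.

Lemma is_idealB J f g : is_ideal J -> J f -> J g -> J (f - g).
Proof.
move=> Jid Jf /(is_idealZ (-1) Jid); rewrite scaleN1r.
by case: Jid => _ JD _ /(JD _ _ Jf).
Qed.

Lemma graded_initial_ideal w J : is_ideal J -> is_ideal (graded_initial w J).
Proof.
move=> Jid; have [J0 JD JM] := Jid.
have GD f g : graded_initial w J f -> graded_initial w J g -> graded_initial w J (f + g).
  move=> Gf Gg W; have [f' [Jf' lef eqf]] := Gf W; have [g' [Jg' leg eqg]] := Gg W.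
  exists (f' + g'); split=> [|m|m mW]; first exact: JD.
    rewrite mcoeffD; have [->|/lef//] := eqVneq (f'@_m) 0.
    by rewrite add0r => /leg.
  by rewrite !mcoeffD eqf ?eqg.
have G0 : graded_initial w J 0 by move=> W; exists 0; split=> // m; rewrite mcoeff0 eqxx.
split=> // h g Gg; rewrite [h]mpolyE mulr_suml; elim/big_ind: _ => // u _ W.
have [f [Jf lef eqf]] := Gg (W - weight w u).
exists (h@_u *: 'X_[u] * f); split=> [|m|m mW]; first exact: JM.
  rewrite mcoeff_mulX; case: ifP => [um|]; last by rewrite eqxx.
  rewrite mulf_eq0 negb_or => /andP[_ /lef]; rewrite -{2}(submK um) weightD; lra.
rewrite !mcoeff_mulX; case: ifP => // um; rewrite eqf // -mW -{2}(submK um) weightD.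
by rewrite addrK.
Qed.

Lemma initial_form_graded w J f :
  is_ideal J -> J f -> graded_initial w J (initial_form w f).
Proof.
move=> [J0 _ _] Jf W.
(* [f] itself works when [W] is its top weight, and [0] otherwise. *)
have [[m0 [m0W m0f f_le]]|noW] := EM (exists m, [/\ weight w m = W, f@_m != 0
    & all (fun m' => weight w m' <= W) (msupp f)]).
  exists f; split=> // m.
    by rewrite -mcoeff_msupp => /(allP f_le).
  by move=> mW; rewrite mcoeff_initial_form mW f_le.
exists 0; split=> // m; first by rewrite mcoeff0 eqxx.
move=> mW; rewrite mcoeff_initial_form mcoeff0 mW; case: ifP => // f_le.
apply/esym/eqP/negPn/negP => mf; apply: noW.
by exists m.
Qed.

(** The right-hand side is an ideal; and an element of it is the sum of its
   components for the weight, each of which is zero or an initial form. *)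
Lemma initial_idealE w J : is_ideal J -> initial_ideal w J = graded_initial w J.
Proof.
move=> Jid; apply/seteqP; split=> [g|g Gg].
  apply; split; first exact: graded_initial_ideal.
  by move=> _ [f [Jf _] <-]; apply: initial_form_graded.
move=> K [Kid KJ]; rewrite [g](sum_components (weight w)).
apply: is_ideal_sum => // W _; have [f [Jf f_le f_eq]] := Gg W.
set gW := mrestrict _ g; have [->|gW0] := eqVneq gW 0; first by case: Kid.
have [m0 m0W m0f] : exists2 m, weight w m = W & f@_m != 0.
  exists (mlead gW); have := mlead_supp gW0; rewrite mcoeff_msupp mcoeff_restrict.
    by case: (eqVneq (weight w _) W) => //; rewrite eqxx.
  by case: (eqVneq (weight w _) W) => [mW|_]; rewrite ?eqxx // f_eq.
apply: KJ; exists f; first by split=> // f0; move: m0f; rewrite f0 mcoeff0 eqxx.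
apply/mpolyP => m; rewrite mcoeff_initial_form mcoeff_restrict.
have [mW|mW] := eqVneq (weight w m) W.
  by rewrite mW f_eq // ifT //; apply/allP => m'; rewrite mcoeff_msupp => /f_le.
case: ifP => // /allP le_m; apply/eqP/negPn/negP => /f_le m_le.
by move: mW; rewrite eq_le m_le -m0W le_m // mcoeff_msupp.
Qed.

End GradedInitial.

Section Homogeneous.
Variables (k : fieldType) (R : realType) (n : nat) (A : zmodType) (a : 'I_n -> A).
Implicit Types (w v : 'rV[R]_n) (f g : {mpoly k[n]}) (J I : set {mpoly k[n]}).

(** Stability under all projections onto sums of graded pieces; for ideals this
   is homogeneity, in the form that is applied below. *)
Definition graded J : Prop :=
  forall (Q : pred A) f, J f -> J (mrestrict (fun m => Q (mondeg a m)) f).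

Lemma homogeneous_graded J : is_ideal J -> homogeneous a J -> graded J.
Proof.
move=> Jid hJ Q f; rewrite {1}hJ => -[gs gsP ->]; rewrite linear_sum.
apply: is_ideal_sum => // g /gsP[s _ [Jg gs_s]] /=.
have gm m : g@_m != 0 -> mondeg a m = s by rewrite -mcoeff_msupp => /gs_s.
have [Qs|Qs] := boolP (Q s).
  by rewrite mrestrict_id // => m /gm->.
by rewrite mrestrict0 => [|m /gm->//]; case: Jid.
Qed.

Lemma graded_initial_graded w J : graded J -> graded (graded_initial w J).
Proof.
move=> gJ Q g Gg W; have [f [Jf f_le f_eq]] := Gg W.
exists (mrestrict (fun m => Q (mondeg a m)) f); split=> [|m|m mW]; first exact: gJ.
  by rewrite mcoeff_restrict; case: ifP; rewrite ?eqxx // => _ /f_le.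
by rewrite !mcoeff_restrict f_eq.
Qed.

Lemma truncationE (Omega : set A) J : is_ideal J -> graded J ->
  truncation a Omega J = [set f | J f /\ forall m, f@_m != 0 -> Omega (mondeg a m)].
Proof.
move=> Jid gJ; have [J0 JD _] := Jid; apply/seteqP; split=> f.
  move=> [gs gsP ->]; split.
    by apply: is_ideal_sum => // g /gsP[s _ []].
  move=> m mf; apply: contrapT => nOm; case/negP: mf; apply/eqP.
  rewrite raddf_sum big1_seq //= => g /gsP[s Os [_ gs_s]].
  apply/eqP/negPn/negP; rewrite -mcoeff_msupp => /gs_s ms.
  by apply: nOm; rewrite ms.
move=> [Jf fO]; pose part s := mrestrict (fun m => mondeg a m == s) f.
exists (map part (undup (map (mondeg a) (msupp f)))).
  move=> _ /mapP[s + ->]; rewrite mem_undup => /mapP[m mf ->].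
  exists (mondeg a m); first by apply: fO; rewrite -mcoeff_msupp.
  split; first exact: gJ (pred1 _) _ Jf.
  move=> m'; rewrite mcoeff_msupp mcoeff_restrict.
  by case: (eqVneq (mondeg a m') _) => //; rewrite eqxx.
by rewrite big_map; apply: sum_components.
Qed.

Section Saturation.
Variables (Omega : set A) (I : set {mpoly k[n]}).
Hypotheses (Omega_tr : truncating a Omega) (Iid : is_ideal I) (gI : graded I).

Definition in_trunc (m : 'X_{1..n}) : bool := `[< Omega (mondeg a m) >].

(** The sum of [I] and of the monomials with degree outside [Omega].  That it
   is an ideal is where [Omega] has to be truncating. *)
Definition saturation : set {mpoly k[n]} := [set f | I (mrestrict in_trunc f)].

Lemma saturation_ideal : is_ideal saturation.
Proof.
have [I0 ID IM] := Iid; split.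
- by rewrite /saturation /= linear0.
- by move=> f g; rewrite /saturation /= linearD; apply: ID.
- move=> h f If; rewrite /saturation /=.
  have -> : mrestrict in_trunc (h * f) = mrestrict in_trunc (h * mrestrict in_trunc f).
    apply/eqP; rewrite -subr_eq0 -linearB -mulrBr /=; apply/eqP.
    apply: mrestrict0 => m; rewrite -mcoeff_msupp => /msuppM_le.
    move=> /allpairsP[[m1 m2] /= [_ + ->]]; rewrite mcoeff_msupp mcoeffB mcoeff_restrict.
    case: ifP => [_|/asboolPn m2O _]; first by rewrite subrr eqxx.
    apply/asboolPn; rewrite mondegD => m12O; apply: m2O.
    have degm m' : degrees a (mondeg a m') by exists m'.
    by have [_ /(_ _ _ (degm m1) (degm m2) m12O)[]] := Omega_tr.
  exact: gI (fun s => `[< Omega s >]) _ (IM _ _ If).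
Qed.

Lemma saturation_graded : graded saturation.
Proof.
move=> Q f If; rewrite /saturation /=.
have -> : mrestrict in_trunc (mrestrict (fun m => Q (mondeg a m)) f) =
    mrestrict (fun m => Q (mondeg a m)) (mrestrict in_trunc f).
  by apply/mpolyP => m; rewrite !mcoeff_restrict; case: ifP => //; rewrite if_same.
exact: gI.
Qed.

Lemma graded_initial_saturation w g :
  graded_initial w saturation g <-> graded_initial w I (mrestrict in_trunc g).
Proof.
split=> Gg W; have [f [If f_le f_eq]] := Gg W.
  exists (mrestrict in_trunc f); split=> // m.
    by rewrite mcoeff_restrict; case: ifP; rewrite ?eqxx // => _ /f_le.
  by move=> mW; rewrite !mcoeff_restrict f_eq.
exists (mrestrict in_trunc f + mrestrict (fun m => ~~ in_trunc m && (weight w m == W)) g).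
split=> [|m|m mW].
- rewrite /saturation /= linearD /= [X in _ + X]mrestrict0 => [|m]; last first.
    by rewrite mcoeff_restrict; case: ifP => [/andP[]|]; rewrite ?eqxx.
  rewrite addr0; apply: (gI (fun s => `[< Omega s >])).
  exact: (gI (fun s => `[< Omega s >])).
- rewrite mcoeffD !mcoeff_restrict; case: ifP => [_|_].
    by rewrite addr0 => /f_le.
  by case: ifP => [/andP[_ /eqP->]//|]; rewrite addr0 eqxx.
- rewrite mcoeffD !mcoeff_restrict mW eqxx andbT f_eq // mcoeff_restrict.
  by case: (in_trunc m); rewrite /= ?addr0 ?add0r.
Qed.

(** The truncation can thus be removed, by replacing the ideal: outside [Omega]
   the initial ideals of the saturation contain everything, and inside they agree
   with those of [I]. *)
Lemma truncated_class_saturation w :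
  truncated_class a Omega I w =
  [set v | graded_initial v saturation = graded_initial w saturation].
Proof.
have truncE v : truncation a Omega (initial_ideal v I) =
    [set f | graded_initial v saturation f /\ forall m, f@_m != 0 -> Omega (mondeg a m)].
  rewrite initial_idealE // truncationE; last 2 first.
  - exact: graded_initial_ideal.
  - exact: graded_initial_graded.
  apply/seteqP; split=> f [Gf fO]; split=> //.
    apply/graded_initial_saturation; rewrite mrestrict_id // => m /fO ?.
    exact/asboolP.
  move/graded_initial_saturation: Gf; rewrite mrestrict_id // => m /fO ?.
  exact/asboolP.
apply/seteqP; split=> v; rewrite /truncated_class /= !truncE; last by move=> ->.
move=> eq_tr.
have restr (u : 'rV[R]_n) g : graded_initial u saturation g <->
    [set f | graded_initial u saturation f /\ forall m, f@_m != 0 -> Omega (mondeg a m)]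
      (mrestrict in_trunc g).
  split=> [Gg|[Gg _]].
    split=> [|m].
      exact: (graded_initial_graded saturation_graded (fun s => `[< Omega s >])).
    by rewrite mcoeff_restrict; case: ifP => [/asboolP//|]; rewrite eqxx.
  apply/graded_initial_saturation; move/graded_initial_saturation: Gg.
  by rewrite mrestrict_id // => m; rewrite mcoeff_restrict; case: ifP; rewrite ?eqxx.
by apply/seteqP; split=> g; rewrite !restr eq_tr.
Qed.

End Saturation.
End Homogeneous.

(** * Finite determinacy *)

Lemma seq_max (T : eqType) (r : rel T) (s : seq T) (x : T) :
  total r -> transitive r -> x \in s ->
  exists2 y, y \in s & forall z, z \in s -> r z y.
Proof.
move=> r_total r_trans; have r_refl z : r z z by case/orP: (r_total z z).
elim: s x => // x [|x' s] IHs _ _.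
  by exists x; rewrite ?inE ?eqxx // => z; rewrite inE => /eqP->.
have [y ys y_max] := IHs x' (mem_head _ _).
have [xy|yx] := orP (r_total x y).
  by exists y => [|z]; rewrite inE ?ys ?orbT // => /predU1P[->//|/y_max].
exists x => [|z]; rewrite inE ?eqxx // => /predU1P[->//|/y_max zy].
exact: r_trans zy yx.
Qed.

Lemma subm_le n (m j : 'X_{1..n}) : (m - j <= m)%MM.
Proof. by apply/mnm_lepP => i; rewrite mnmBE leq_subr. Qed.

Lemma subm_sub n (m j : 'X_{1..n}) : (j <= m)%MM -> (m - (m - j))%MM = j.
Proof. by move/mnm_lepP=> jm; apply/mnmP => i; rewrite !mnmBE subKn. Qed.

Section LeadingMonomials.
Variables (k : fieldType) (R : realType) (n : nat).
Implicit Types (w v : 'rV[R]_n) (f g h : {mpoly k[n]}) (m j : 'X_{1..n}).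

(** The order by weight, with ties broken by a fixed monomial order.  It need not
   be a well-order, as weights may be negative; finiteness of the graded pieces
   makes up for that. *)
Definition wle w m m' : bool :=
  (weight w m < weight w m') || ((weight w m == weight w m') && (m <= m')%O).

Lemma wle_total w : total (wle w).
Proof.
move=> m m'; rewrite /wle; case: (ltgtP (weight w m) (weight w m')) => //= _.
exact: le_total.
Qed.

Lemma wle_trans w : transitive (wle w).
Proof.
move=> m2 m1 m3 /orP[lt12|/andP[/eqP e12 le12]] /orP[lt23|/andP[/eqP e23 le23]];
  rewrite /wle.
- by rewrite (lt_trans lt12 lt23).
- by rewrite -e23 lt12.
- by rewrite e12 lt23.
- by rewrite e12 e23 eqxx (le_trans le12 le23) orbT.
Qed.

Lemma wle_anti w : antisymmetric (wle w).
Proof.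
move=> m m'; rewrite /wle; case: (ltgtP (weight w m) (weight w m')) => //= _.
exact: le_anti.
Qed.

Lemma wle_add2l w u m m' : wle w (u + m)%MM (u + m')%MM = wle w m m'.
Proof. by rewrite /wle !weightD ltrD2l (inj_eq (addrI _)) lemc_add2r. Qed.

Variable J : set {mpoly k[n]}.
Hypothesis Jid : is_ideal J.

Definition leads w f j : Prop := f@_j != 0 /\ forall m, f@_m != 0 -> wle w m j.

Definition lead_monomial w j : Prop := exists2 f, J f & leads w f j.

Lemma leads_exists w f : f != 0 -> exists j, leads w f j.
Proof.
move=> /mlead_supp f0.
have [j jf j_max] := seq_max (@wle_total w) (@wle_trans w) f0.
by exists j; split=> [|m]; rewrite -mcoeff_msupp // => /j_max.
Qed.

(** On monomials of equal weight [wle w] is the tie-breaking order, so the element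
   of [J] whose top-weight part is the component of [g] of the weight of
   [mlead g] is led by [mlead g]. *)
Lemma leads_graded_initial w g : graded_initial w J g -> g != 0 ->
  lead_monomial w (mlead g).
Proof.
move=> Gg g0; have [f [Jf f_le f_eq]] := Gg (weight w (mlead g)).
exists f => //; split; first by rewrite f_eq // -mcoeff_msupp mlead_supp.
move=> m mf; rewrite /wle lt_neqAle f_le // andbT.
have [mW|//] := eqVneq; rewrite /= msupp_le_mlead // mcoeff_msupp.
by rewrite -f_eq.
Qed.

Variables (A : zmodType) (a : 'I_n -> A).
Hypothesis posA : positively_graded k a.
Hypothesis gJ : graded a J.

Definition same_degree j : pred 'X_{1..n} := fun m => mondeg a m == mondeg a j.

Section Reduction.
Variables (w : 'rV[R]_n) (gens : seq 'X_{1..n}) (B : 'X_{1..n}).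
Hypothesis gens_lead : forall j, j \in gens -> lead_monomial w j.

(** [f] is congruent modulo [J] to a combination of monomials outside the ideal
   generated by [gens] and smaller than [B]. *)
Let reducible f := exists2 r, J (f - r) & forall m, r@_m != 0 ->
  ~~ mdivisible gens m /\ (wle w m B /\ m != B).

Let reducible_lin c f g : reducible f -> reducible g -> reducible (c *: f + g).
Proof.
move=> [r Jr rP] [s Js sP]; exists (c *: r + s).
  rewrite opprD addrACA -scalerBr; case: Jid => _ JD _.
  by apply: JD => //; apply: is_idealZ.
move=> m; rewrite mcoeffD mcoeffZ; have [->|/rP//] := eqVneq (r@_m) 0.
by rewrite mulr0 add0r => /sP.
Qed.

Let reducible_sum f :
  (forall m, f@_m != 0 -> reducible 'X_[m]) -> reducible f.
Proof.
move=> fP; rewrite [f]mpolyE big_seq; elim/big_ind: _.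
- by exists 0; [rewrite subrr; case: Jid | move=> m; rewrite mcoeff0 eqxx].
- by move=> x y rx ry; rewrite -[x]scale1r; apply: reducible_lin.
move=> m; rewrite mcoeff_msupp => /fP rm; rewrite -[_ *: _]addr0.
apply: reducible_lin => //.
by exists 0; [rewrite subrr; case: Jid | move=> m'; rewrite mcoeff0 eqxx].
Qed.

(** Division with remainder by elements of [J] with leading monomials [gens].  It
   terminates because a monomial is only replaced by smaller ones of the same
   degree; formally, [m0] is the smallest counterexample of its degree. *)
Lemma reduce_monomial m : wle w m B -> m != B -> reducible 'X_[m].
Proof.
move=> mB m_neq; apply: contrapT => m_irr.
have [E EP] := finite_degree posA (mondeg a m).
pose bad m' := `[< [/\ wle w m' B, m' != B & ~ reducible 'X_[m'] ] >].
have m_in : m \in [seq x <- E | bad x].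
  by rewrite mem_filter EP eqxx andbT; apply/asboolP.
have ge_total : total (fun x y => wle w y x) by move=> x y; apply: wle_total.
have ge_trans : transitive (fun x y => wle w y x).
  by move=> y x z yx zy; apply: wle_trans zy yx.
(* The maximum for the opposite order. *)
have [m0] := seq_max ge_total ge_trans m_in.
rewrite mem_filter EP => /andP[/asboolP[m0B m0_neq m0_irr] /eqP m0_deg] m0_min.
have smaller m' : mondeg a m' = mondeg a m -> wle w m' m0 -> m' != m0 ->
    reducible 'X_[m'].
  move=> m'_deg m'm0 neq; apply: contrapT => m'_irr; move/negP: neq; apply.
  apply/eqP/(@wle_anti w); rewrite m'm0 m0_min // mem_filter EP m'_deg eqxx andbT.
  apply/asboolP; split=> //; first exact: wle_trans m'm0 m0B.
  apply: contra_notN m'_irr => /eqP m'B; move: m0_neq; rewrite -m'B.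
  by rewrite (@wle_anti w m0 m') ?eqxx // m'm0 m'B m0B.
have [j_dvd|m0_std] := boolP (mdivisible gens m0); last first.
  apply: m0_irr; exists 'X_[m0]; first by rewrite subrr; case: Jid.
  by move=> m'; rewrite mcoeffX; case: (eqVneq m0 m') => [<-|_]; rewrite ?eqxx.
have /hasP[j /gens_lead[f Jf [fj f_lead]] jm0] := j_dvd.
pose h := (f@_j)^-1 *: 'X_[m0 - j] * mrestrict (same_degree j) f.
have hE m' : h@_m' = if (m0 - j <= m')%MM && same_degree j (m' - (m0 - j))%MM
    then (f@_j)^-1 * f@_(m' - (m0 - j)) else 0.
  by rewrite mcoeff_mulX mcoeff_restrict; case: ifP => //=; case: ifP; rewrite ?mulr0.
have Jh : J h by case: Jid => _ _; apply; exact: gJ (pred1 _) _ Jf.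
apply: m0_irr.
have [r Jr rP] : reducible ('X_[m0] - h).
  apply: reducible_sum => m'; rewrite mcoeffB mcoeffX hE.
  have [<-|m'm0] := eqVneq m0 m'.
    by rewrite (subm_le _ _) (subm_sub jm0) /same_degree eqxx /= mulVf // subrr eqxx.
  rewrite sub0r oppr_eq0; case: ifP => [/andP[le_m' /eqP deg_m']|]; last by rewrite eqxx.
  rewrite mulf_eq0 negb_or => /andP[_ /f_lead].
  rewrite -(wle_add2l w (m0 - j)%MM) [(m0 - j + (m' - _))%MM]addmC !submK // => m'm0'.
  apply: smaller => //; last by rewrite eq_sym.
  by rewrite -m0_deg -(submK le_m') mondegD deg_m' addrC -mondegD submK.
exists r => //; rewrite -[X in X - r](subrK h) addrAC.
by case: Jid => _ JD _; apply: JD.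
Qed.

Lemma normal_form f : (forall m, f@_m != 0 -> wle w m B /\ m != B) ->
  exists2 r, J (f - r) & forall m, r@_m != 0 ->
    ~~ mdivisible gens m /\ (wle w m B /\ m != B).
Proof.
move=> f_lt; apply: reducible_sum => m /f_lt[mB m_neq].
exact: reduce_monomial.
Qed.

End Reduction.

(** If every nonzero element of [J] has a monomial divisible by [gens], then the
   monomials not divisible by [gens] are independent modulo [J], and the ideal of
   leading monomials cannot be larger than the one generated by [gens]: reducing
   the lower terms of an element with another leading monomial would give a
   relation between independent monomials. *)
Lemma leads_divisible w gens :
  (forall j, j \in gens -> lead_monomial w j) ->
  (forall f, J f -> f != 0 -> exists2 m, f@_m != 0 & mdivisible gens m) ->
  forall m, lead_monomial w m -> mdivisible gens m.
Proof.
move=> gens_lead indep m [f Jf [fm f_lead]].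
apply: contrapT => /negP m_std.
have [|r Jr rP] := @normal_form w gens m gens_lead (f - f@_m *: 'X_[m]).
  move=> m'; rewrite mcoeffB mcoeffZ mcoeffX.
  have [<-|neq] := eqVneq m m'; first by rewrite mulr1 subrr eqxx.
  by rewrite mulr0 subr0 => /f_lead; split=> //; rewrite eq_sym.
pose s := f@_m *: 'X_[m] + r.
have sE m' : s@_m' = if m == m' then f@_m else r@_m'.
  rewrite mcoeffD mcoeffZ mcoeffX.
  have [<-|_] := eqVneq m m'; last by rewrite mulr0 add0r.
  rewrite mulr1; have [->|/rP[_ [_]]] := eqVneq (r@_m) 0; first by rewrite addr0.
  by rewrite eqxx.
have Js : J s.
  have -> : s = f - (f - f@_m *: 'X_[m] - r) by rewrite -addrA -opprD subKr.
  exact: is_idealB.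
have s0 : s != 0.
  by apply: contraNneq fm => s0; have := sE m; rewrite eqxx s0 mcoeff0 => ->.
have [m'] := indep s Js s0; rewrite sE; case: (eqVneq m m') => [<- _|_ /rP[m'_std _]].
  by rewrite (negPf m_std).
by rewrite (negPf m'_std).
Qed.

(** Finitely many monomials suffice to generate the ideals of leading monomials
   for all [w] together.  By induction on the ideal generated by [gens], this is
   shown for the [w] for which all of [gens] are leading monomials: either these
   already generate, or some [f] in [J] has no monomial divisible by [gens], and
   then its leading monomial, for which there are only finitely many choices,
   can be added to [gens]. *)
Lemma uniform_leads : exists G : seq 'X_{1..n}, forall w m, lead_monomial w m ->
  exists j, [/\ j \in G, lead_monomial w j & (j <= m)%MM].
Proof.
suff [G GP] : exists G : seq 'X_{1..n}, forall w,
    (forall j, j \in [::] -> lead_monomial w j) ->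
    forall m, lead_monomial w m ->
    exists j, [/\ j \in G, lead_monomial w j & (j <= m)%MM].
  by exists G => w; apply: GP.
pose good (gens G : seq 'X_{1..n}) := forall w,
  (forall j, j \in gens -> lead_monomial w j) -> forall m, lead_monomial w m ->
  exists j, [/\ j \in G, lead_monomial w j & (j <= m)%MM].
apply: (@dickson_ind n (fun gens => exists G, good gens G)) => gens IH.
have [[f [Jf f0 f_std]]|no_std] := EM (exists f,
    [/\ J f, f != 0 & forall m, f@_m != 0 -> ~~ mdivisible gens m]); last first.
  exists gens => w gens_lead m m_lead.
  have /hasP[j jg jm] : mdivisible gens m.
    apply: leads_divisible m_lead => // f Jf f0.
    apply: contrapT => nm; apply: no_std; exists f; split=> // m' m'f.
    by apply/negP => m'_dvd; apply: nm; exists m'.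
  by exists j; split=> //; apply: gens_lead.
have [G GP] : exists G, forall m, m \in msupp f -> good (m :: gens) G.
  have : {subset msupp f <= msupp f} by [].
  elim: {1 3}(msupp f) => [|m s IHs] sub; first by exists [::].
  have [m' m's|G GP] := IHs; first by apply: sub; rewrite inE m's orbT.
  have [|G' G'P] := IH m; first by apply: f_std; rewrite -mcoeff_msupp sub ?mem_head.
  exists (G' ++ G) => m'; rewrite inE => /predU1P[->|m's] w lead_gens u u_lead.
    have [j [jG' ? ?]] := G'P w lead_gens u u_lead.
    by exists j; rewrite mem_cat jG'.
  have [j [jG ? ?]] := GP m' m's w lead_gens u u_lead.
  by exists j; rewrite mem_cat jG orbT.
exists G => w gens_lead; have [m m_lead] := leads_exists w f0.
have mf : m \in msupp f by rewrite mcoeff_msupp; case: m_lead.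
apply: (GP m mf) => j; rewrite inE => /predU1P[->|/gens_lead//].
by exists f.
Qed.

(** The set [E] is the union of the graded pieces of the degrees that occur in
   [uniform_leads].  If two initial ideals agree on [E], the elements of the first
   with leading monomials in [E] are in the second; these leading monomials
   generate, so every element of the first reduces to zero by elements of both. *)
Lemma finite_determinacy : exists E : seq 'X_{1..n},
  [/\ uniq E, forall m m', mondeg a m = mondeg a m' -> (m \in E) = (m' \in E) &
  forall v w, (forall g, (forall m, g@_m != 0 -> m \in E) ->
      graded_initial v J g <-> graded_initial w J g) ->
    graded_initial v J = graded_initial w J].
Proof.
have [G GP] := uniform_leads.
have [E [E_uniq E_deg GE]] : exists E : seq 'X_{1..n}, [/\ uniq E,
    forall m m', mondeg a m = mondeg a m' -> (m \in E) = (m' \in E)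
    & {subset G <= E}].
  elim: G {GP} => [|j G [E [E_uniq E_deg GE]]]; first by exists [::].
  have [F FP] := finite_degree posA (mondeg a j).
  exists (undup (F ++ E)); split; first exact: undup_uniq.
    by move=> m m' mm'; rewrite !mem_undup !mem_cat !FP mm' (E_deg _ _ mm').
  move=> m; rewrite inE mem_undup mem_cat FP => /predU1P[->|/GE->]; rewrite ?eqxx //.
  by rewrite orbT.
exists E; split=> //.
suff sub v w : (forall g, (forall m, g@_m != 0 -> m \in E) ->
      graded_initial v J g <-> graded_initial w J g) ->
    graded_initial v J `<=` graded_initial w J.
  move=> v w agree; apply/seteqP; split; apply: sub => // g gE.
  by split=> /agree; apply.
move=> agree.
have [_ GvD GvM] := graded_initial_ideal v Jid.
have [Gw0 GwD GwM] := graded_initial_ideal w Jid.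
(* Cancel the leading term of [g] with a multiple of some [h] supported on [E]. *)
elim/mleadrect => g IHg Gg.
have [->//|g0] := eqVneq g 0.
have [j [jG [f Jf [fj f_lead]] jm]] := GP v _ (leads_graded_initial Gg g0).
pose h := mrestrict (same_degree j) (initial_form v f).
have Gh : graded_initial v J h.
  by apply: (graded_initial_graded gJ (pred1 _)); apply: initial_form_graded.
have hj : h@_j = f@_j.
  rewrite mcoeff_restrict /same_degree eqxx mcoeff_initial_form ifT //.
  apply/allP => m'; rewrite mcoeff_msupp => /f_lead /orP[/ltW//|/andP[/eqP->//]].
have h_le m' : h@_m' != 0 -> (m' <= j)%O.
  rewrite mcoeff_restrict; case: ifP => _; last by rewrite eqxx.
  rewrite mcoeff_initial_form; case: ifP => [/allP le_m'|_]; last by rewrite eqxx.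
  have {le_m'} := le_m' j; rewrite mcoeff_msupp => /(_ fj) le_jm' /f_lead.
  by rewrite /wle ltNge le_jm' => /andP[].
have Gwh : graded_initial w J h.
  apply/agree => // m'; rewrite mcoeff_restrict; case: ifP => [/eqP eq_deg _|].
    by rewrite (E_deg _ _ eq_deg) GE.
  by rewrite eqxx.
pose q := (g@_(mlead g) / f@_j) *: 'X_[mlead g - j] * h.
rewrite -(subrK q g); apply: GwD; last exact: GwM.
have [->//|nz] := eqVneq (g - q) 0.
apply: IHg; last exact: (is_idealB (graded_initial_ideal v Jid) Gg (GvM _ _ Gh)).
have := mlead_supp nz; rewrite mcoeff_msupp; set m' := mlead (g - q).
rewrite mcoeffB mcoeff_mulX lt_neqAle => nz'; apply/andP; split.
  apply: contraNneq nz' => ->.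
  by rewrite (subm_le _ _) (subm_sub jm) hj divfK // subrr.
have [gm'|gm'] := boolP (m' \in msupp g); first exact: msupp_le_mlead.
move: nz'; rewrite (memN_msupp_eq0 gm') sub0r oppr_eq0.
case: ifP => [um'|]; last by rewrite eqxx.
rewrite mulf_eq0 negb_or => /andP[_ /h_le].
by rewrite -(lemc_add2r (mlead g - j)%MM) [(mlead g - j + (m' - _))%MM]addmC !submK.
Qed.

End LeadingMonomials.

(** * The fan of initial ideals *)

Section Coordinates.
Variables (k : fieldType) (R : realType) (n : nat) (E : seq 'X_{1..n}).
Hypothesis E_uniq : uniq E.
Implicit Types (x y : 'rV[k]_(size E)) (f g : {mpoly k[n]}) (w : 'rV[R]_n).

Definition mon (i : 'I_(size E)) : 'X_{1..n} := tnth (in_tuple E) i.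

Definition mpoly_of_row x : {mpoly k[n]} := \sum_i x 0 i *: 'X_[mon i].

Definition row_of_mpoly f : 'rV[k]_(size E) := \row_i f@_(mon i).

Lemma mon_inj : injective mon.
Proof. by move=> i j; apply/tuple_uniqP. Qed.

Lemma monP m : reflect (exists i, mon i = m) (m \in E).
Proof. by apply: (iffP (tnthP (in_tuple E) m)) => [[i ->]|[i <-]]; exists i. Qed.

Lemma mpoly_of_row_is_linear : linear mpoly_of_row.
Proof.
move=> c x y; rewrite /mpoly_of_row scaler_sumr -big_split; apply: eq_bigr => i _.
by rewrite !mxE scalerDl scalerA.
Qed.

HB.instance Definition _ := GRing.isLinear.Build k 'rV[k]_(size E) {mpoly k[n]} *:%R
  mpoly_of_row mpoly_of_row_is_linear.

Lemma mcoeff_mpoly_of_row x i : (mpoly_of_row x)@_(mon i) = x 0 i.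
Proof.
rewrite raddf_sum /= (bigD1 i) //= mcoeffZ mcoeffX eqxx mulr1 big1 ?addr0 // => j ji.
by rewrite mcoeffZ mcoeffX (inj_eq mon_inj) (negPf ji) mulr0.
Qed.

Lemma mcoeff_mpoly_of_row_out x m : m \notin E -> (mpoly_of_row x)@_m = 0.
Proof.
move=> mE; rewrite raddf_sum big1 //= => i _; rewrite mcoeffZ mcoeffX.
case: eqP => [im|]; last by rewrite mulr0.
by case/monP: mE; exists i.
Qed.

Lemma row_of_mpolyK f : (forall m, f@_m != 0 -> m \in E) ->
  mpoly_of_row (row_of_mpoly f) = f.
Proof.
move=> fE; apply/mpolyP => m; have [/monP[i <-]|mE] := boolP (m \in E).
  by rewrite mcoeff_mpoly_of_row mxE.
rewrite mcoeff_mpoly_of_row_out //; apply/esym/eqP.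
by apply: contraNT mE => /fE.
Qed.

Variables (A : zmodType) (a : 'I_n -> A) (J : set {mpoly k[n]}).
Hypothesis gJ : graded a J.
Hypothesis E_deg : forall m m', mondeg a m = mondeg a m' -> (m \in E) = (m' \in E).

Lemma graded_initial_coordinates w y :
  graded_initial w J (mpoly_of_row y) <->
  initial_space (fun i => weight w (mon i)) [set x | J (mpoly_of_row x)] y.
Proof.
split=> Gy W; last first.
  have [x [Jx x_le x_eq]] := Gy W; exists (mpoly_of_row x); split=> // m.
    have [/monP[i <-]|mE] := boolP (m \in E).
      by rewrite mcoeff_mpoly_of_row => /x_le.
    by rewrite mcoeff_mpoly_of_row_out // eqxx.
  have [/monP[i <-]|mE] := boolP (m \in E).
    by rewrite !mcoeff_mpoly_of_row => /x_eq.
  by rewrite !mcoeff_mpoly_of_row_out.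
have [f [Jf f_le f_eq]] := Gy W.
pose Q s := s \in map (mondeg a) E.
have QE m : Q (mondeg a m) = (m \in E).
  by apply/mapP/idP => [[m' m'E /E_deg->//]|mE]; exists m.
exists (row_of_mpoly (mrestrict (fun m => Q (mondeg a m)) f)); split=> /=.
- rewrite row_of_mpolyK; first exact: gJ.
  by move=> m; rewrite mcoeff_restrict QE; case: ifP; rewrite ?eqxx.
- by move=> i; rewrite mxE mcoeff_restrict; case: ifP => [_ /f_le|]; rewrite ?eqxx.
- move=> i iW; rewrite mxE mcoeff_restrict QE ifT; last by apply/monP; exists i.
  by rewrite f_eq // mcoeff_mpoly_of_row.
Qed.

End Coordinates.

(** The points span the state polytope of [J]: they are the sums of the exponents
   of the monomials in a basis of the matroid of the part of [J] supported on the
   set of [finite_determinacy]. *)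
Lemma graded_initial_maximizers (k : fieldType) (R : realType) (n : nat)
    (A : zmodType) (a : 'I_n -> A) (J : set {mpoly k[n]}) :
  positively_graded k a -> is_ideal J -> graded a J ->
  exists (T : finType) (B : {set T}) (p : T -> 'rV[R]_n), B != finset.set0 /\
    forall v w, graded_initial v J = graded_initial w J <->
      maximizers B p v = maximizers B p w.
Proof.
move=> posA Jid gJ.
have [E [E_uniq E_deg E_det]] := finite_determinacy R Jid posA gJ.
have [J0 JD _] := Jid.
have V0 : J (mpoly_of_row (0 : 'rV[k]_(size E))) by rewrite linear0.
have Vlin c (x y : 'rV[k]_(size E)) : J (mpoly_of_row x) -> J (mpoly_of_row y) ->
    J (mpoly_of_row (c *: x + y)).
  by move=> Jx Jy; rewrite linearP; apply: JD => //; apply: is_idealZ.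
have [d [M [freeM VM]]] := linear_set_basis (S := [set x | J (mpoly_of_row x)]) V0 Vlin.
have {}VM : [set x | J (mpoly_of_row x)] = [set x : 'rV[k]_(size E) | (x <= M)%MS].
  by apply/seteqP; split=> x /VM.
pose p (g : {ffun 'I_d -> 'I_(size E)}) : 'rV[R]_n :=
  \sum_b \row_i (mon (g b) i)%:R.
exists {ffun 'I_d -> 'I_(size E)}, (col_bases M), p; split; first exact: col_bases_neq0.
have dot_p x g : dotv x (p g) = col_weight (fun i => weight x (mon i)) g.
  rewrite linear_sum; apply: eq_bigr => b _.
  by apply: eq_bigr => i _; rewrite mxE.
have max_opt x : maximizers (col_bases M) p x =
    optimal_bases M (fun i => weight x (mon i)).
  apply/finset.setP => g; rewrite [LHS]inE [RHS]inE; congr (_ && _).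
  by apply: eq_forallb => h; rewrite !dot_p.
have coord := graded_initial_coordinates E_uniq gJ E_deg.
move=> v w; rewrite !max_opt -(eq_initial_space freeM) -VM; split=> [eq_G|eq_in].
  by apply/seteqP; split=> y /coord Gy; apply/coord; [rewrite -eq_G|rewrite eq_G].
apply: E_det => g /(row_of_mpolyK E_uniq) <-.
by split=> /coord Gg; apply/coord; [rewrite -eq_in|rewrite eq_in].
Qed.

Theorem theorem3p1 (k : fieldType) (R : realType) (n : nat) (A : zmodType)
    (a : 'I_n -> A) (Omega : set A) (I : set {mpoly k[n]}) :
  positively_graded k a ->
  truncating a Omega ->
  is_ideal I ->
  homogeneous a I ->
  complete_fan (truncated_groebner_fan R a Omega I).
Proof.
move=> posA Omega_tr Iid hI; have gI := homogeneous_graded Iid hI.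
have [T [B [p [B0 pP]]]] := graded_initial_maximizers R posA
  (saturation_ideal Omega_tr Iid gI) (saturation_graded gI).
have -> : truncated_groebner_fan R a Omega I =
    range (fun w => closure [set v | maximizers B p v = maximizers B p w]).
  apply: eq_imagel => w _ /=; congr closure.
  rewrite truncated_class_saturation //.
  by apply/seteqP; split=> v /pP.
exact: complete_normal_fan.
Qed.
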